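(* Let $a < b$ be real numbers, let $f \in C[a,b]$, and let $\alpha > 0$ with $\alpha \notin \mathbb{N}$. Let $n = \lceil \alpha \rceil$ and $c_\alpha = \frac{\sin \pi\alpha}{\pi} \prod_{\ell=1}^{n-1} \frac{1}{\ell-\alpha}$. Let $\psi : \Omega \to (0,\infty)$ be an admissible transformation, and for $t \in [a,b]$, $\omega \in \Omega$ let $$\phi(t,\omega) = c_\alpha\, \psi'(\omega)\, (\psi(\omega))^{n-\alpha-1} \int_a^t (t-\tau)^{n-1} \exp(-(t-\tau)\psi(\omega))\, f(\tau)\, \mathrm{d}\tau .$$ Let $t \in [a,b]$ be fixed. Then: (1) There exists some constant $C \in \mathbb{R}$ such that $$|\phi(t,\omega)| \le C\, \psi'(\omega)\, (\psi(\omega))^{-\alpha-1} \quad \text{for } \omega \to \sup\Omega .$$ (2) There exists some constant $C \in \mathbb{R}$ such that $$|\phi(t,\omega)| \le C\, \psi'(\omega)\, (\psi(\omega))^{n-\alpha-1} \quad \text{for } \omega \to \inf\Omega .$$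
   Context: A function $\psi : \Omega \to (0,\infty)$ is called an admissible transformation if: (i) its domain $\Omega$ is a non-empty open interval of $\mathbb{R}$ (possibly unbounded); (ii) $\psi \in C^1(\Omega)$; (iii) $\psi$ is strictly monotonically increasing; (iv) $\lim_{\omega \to \inf\Omega} \psi(\omega) = 0$ and $\lim_{\omega \to \sup\Omega} \psi(\omega) = +\infty$. Here $\mathbb{N} = \{1,2,3,\ldots\}$, and an empty product equals $1$. An inequality ''for $\omega \to \sup\Omega$'' (respectively ''for $\omega \to \inf\Omega$'') means that there is some $\omega_0 \in \Omega$ such that the inequality holds for all $\omega \in \Omega$ with $\omega > \omega_0$ (respectively $\omega < \omega_0$). The constants $C$ do not depend on $\omega$. *)

(* Defs.v *)
From Stdlib Require Import Reals Zfloor List.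
From Coquelicot Require Import Coquelicot.
Open Scope R_scope.

(* Non-empty open intervals of R, bounded or not; the end points are recovered
   in Rbar as [Glb_Rbar Omega] and [Lub_Rbar Omega]. *)
Record open_interval (Omega : R -> Prop) : Prop := {
  oi_nonempty : exists x, Omega x;
  oi_open : open Omega;
  oi_convex : forall x y z, Omega x -> Omega z -> x <= y <= z -> Omega y
}.

(* A function on Omega is represented by a total function on R whose values
   outside Omega are irrelevant: Omega is open, so [Derive psi x] for x in Omega
   depends only on psi restricted to Omega, and both limits are taken within
   Omega. *)
Record admissible (Omega : R -> Prop) (psi : R -> R) : Prop := {
  adm_dom : open_interval Omega;
  adm_pos : forall x, Omega x -> 0 < psi x;
  adm_derivable : forall x, Omega x -> ex_derive psi x;
  adm_C1 : continuous_on Omega (Derive psi);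
  adm_incr : forall x y, Omega x -> Omega y -> x < y -> psi x < psi y;
  adm_lim_inf :
    filterlim psi (within Omega (Rbar_locally (Glb_Rbar Omega))) (locally 0);
  adm_lim_sup :
    filterlim psi (within Omega (Rbar_locally (Lub_Rbar Omega)))
      (Rbar_locally p_infty)
}.

Definition holds_to_sup (Omega P : R -> Prop) : Prop :=
  exists w0, Omega w0 /\ forall w, Omega w -> w0 < w -> P w.

Definition holds_to_inf (Omega P : R -> Prop) : Prop :=
  exists w0, Omega w0 /\ forall w, Omega w -> w < w0 -> P w.

(* Only used for alpha > 0, where [Z.to_nat] does not truncate. *)
Definition nceil (alpha : R) : nat := Z.to_nat (Zceil alpha).

Definition c_coef (alpha : R) : R :=
  sin (PI * alpha) / PI *
  fold_right Rmult 1
    (map (fun l : nat => 1 / (INR l - alpha)) (seq 1 (nceil alpha - 1))).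

(* [Rpower] is the real power x^y for x > 0; here it is only used at
   x = psi w with w in Omega. *)
Definition phi (a : R) (f : R -> R) (alpha : R) (psi : R -> R) (t w : R) : R :=
  c_coef alpha * Derive psi w * Rpower (psi w) (INR (nceil alpha) - alpha - 1) *
  RInt (fun tau => (t - tau) ^ (nceil alpha - 1) *
                   exp (- (t - tau) * psi w) * f tau) a t.

(* Main.v *)
Require Import Defs.
From Stdlib Require Import Reals Zfloor Factorial Lra Lia.
From Coquelicot Require Import Coquelicot.
Open Scope R_scope.

(** Write n for the ceiling of alpha and s for psi(omega) > 0.  Up to the factor
    c_alpha psi'(omega) s^(n-alpha-1), where psi'(omega) >= 0 because psi is
    increasing ([Derive_ge_0_of_increasing_on]), the function phi(t, omega) is
    the integral over [a, t] of the kernel (t - tau)^(n-1) exp(-(t - tau) s)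
    against f.  The continuous f is bounded on the compact interval [a, b], so
    this integral is at most a bound M of |f| times the integral of any majorant
    of the kernel ([Rabs_RInt_mult_le]).  Both claims come from such estimates,
    valid for all s > 0:

    - extending the integration to tau = -oo turns the kernel integral into
      Gamma(n) / s^n, which gives M (n-1)! / s^n ([laplace_RInt_le_Gamma]); the
      factor s^(-n) changes s^(n-alpha-1) into s^(-alpha-1);
    - the exponential is at most 1, which gives M (t - a) (t - a)^(n-1)
      ([laplace_RInt_le_const]), and s^(n-alpha-1) stays as it is.

    Since s > 0 is arbitrary in them, the threshold omega_0 may be any point of
    Omega. *)

(** * Continuous functions on a compact interval *)

Definition clamp (a b x : R) : R := Rmax a (Rmin b x).

Lemma clamp_in (a b x : R) : a <= b -> a <= clamp a b x <= b.
Proof.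
  intros Hab; unfold clamp, Rmax, Rmin.
  destruct (Rle_dec b x); destruct (Rle_dec a _); lra.
Qed.

Lemma clamp_id (a b x : R) : a <= x <= b -> clamp a b x = x.
Proof.
  intros Hx; unfold clamp, Rmax, Rmin.
  destruct (Rle_dec b x); destruct (Rle_dec a _); lra.
Qed.

Lemma clamp_contract (a b x y : R) :
  Rabs (clamp a b y - clamp a b x) <= Rabs (y - x).
Proof.
  unfold clamp, Rmax, Rmin, Rabs.
  destruct (Rle_dec b x); destruct (Rle_dec b y);
    repeat destruct (Rle_dec a _); repeat destruct (Rcase_abs _); lra.
Qed.

(** Continuity relative to a segment says nothing about the values outside it,
    while the integration and extreme value theorems ask for full continuity at
    the end points.  Precomposing with the retraction [clamp] onto the segment
    provides a continuous function with the same values on it. *)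
Lemma continuous_on_segment_extension (a b : R) (f : R -> R) :
  a <= b -> continuous_on (fun x => a <= x <= b) f ->
  exists g : R -> R,
    (forall x, continuous g x) /\ (forall x, a <= x <= b -> g x = f x).
Proof.
  intros Hab Hf.
  exists (fun x => f (clamp a b x)); split.
  - intros x.
    apply (filterlim_comp _ _ _ (clamp a b) f (locally x)
             (within (fun y => a <= y <= b) (locally (clamp a b x)))).
    + intros P [eps HP].
      exists eps; intros y Hy.
      apply HP; [ | now apply clamp_in].
      apply Rle_lt_trans with (2 := Hy), clamp_contract.
    + now apply Hf, clamp_in.
  - intros x Hx; now rewrite clamp_id.
Qed.

Lemma continuous_segment_bounded (a b : R) (g : R -> R) :
  a <= b -> (forall x, continuous g x) ->
  exists M, 0 <= M /\ forall x, a <= x <= b -> Rabs (g x) <= M.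
Proof.
  intros Hab Hg.
  destruct (continuity_ab_maj (fun x => Rabs (g x)) a b Hab) as [x0 [Hx0 _]].
  { intros c _; apply continuity_pt_filterlim.
    now apply (continuous_Rabs_comp g). }
  exists (Rabs (g x0)); split; [apply Rabs_pos | exact Hx0].
Qed.

Lemma Rabs_RInt_mult_le (a b t : R) (f k h : R -> R) (M K : R) :
  a <= t <= b ->
  continuous_on (fun x => a <= x <= b) f ->
  (forall x, a <= x <= b -> Rabs (f x) <= M) ->
  (forall x, continuous k x) ->
  (forall x, a <= x <= t -> 0 <= k x <= h x) ->
  is_RInt h a t K ->
  Rabs (RInt (fun x => k x * f x) a t) <= M * K.
Proof.
  intros Ht Hf HM Hk Hkh HK.
  destruct (continuous_on_segment_extension a b f) as [g [Hg Hgf]];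
    [lra | exact Hf | ].
  rewrite (RInt_ext _ (fun x => k x * g x)).
  2: { rewrite Rmin_left, Rmax_right by lra.
       intros x Hx; rewrite Hgf; [reflexivity | lra]. }
  apply (norm_RInt_le (fun x => k x * g x) (fun x => M * h x) a t).
  - lra.
  - intros x Hx; change (Rabs (k x * g x) <= M * h x).
    rewrite Rabs_mult, (Rabs_pos_eq (k x)), (Rmult_comm M) by now apply Hkh.
    apply Rmult_le_compat; try apply Hkh; try apply Rabs_pos; try lra.
    rewrite Hgf by lra; apply HM; lra.
  - apply (RInt_correct (fun x => k x * g x)), ex_RInt_continuous.
    intros x _; apply (continuous_mult k g); auto.
  - now apply (is_RInt_scal h a t M).
Qed.

(** * The Laplace kernel *)

(** This is Gamma(m+1, x) / m!, the normalised upper incomplete Gamma function,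
    in closed form.  It gives an explicit antiderivative of x^m exp(-x). *)
Definition upper_gamma (m : nat) (x : R) : R :=
  exp (- x) * sum_f_R0 (fun k => x ^ k / INR (fact k)) m.

Lemma upper_gamma_0 (m : nat) : upper_gamma m 0 = 1.
Proof.
  unfold upper_gamma; rewrite Ropp_0, exp_0, Rmult_1_l.
  induction m as [|m IH]; simpl sum_f_R0.
  - simpl; field.
  - rewrite IH; simpl pow; unfold Rdiv; ring.
Qed.

Lemma upper_gamma_ge_0 (m : nat) (x : R) : 0 <= x -> 0 <= upper_gamma m x.
Proof.
  intros Hx; apply Rmult_le_pos; [left; apply exp_pos | ].
  apply cond_pos_sum; intros k.
  apply Rmult_le_pos; [now apply pow_le | ].
  left; apply Rinv_0_lt_compat, INR_fact_lt_0.
Qed.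

(** Differentiating exp(-x) x^k / k! produces two consecutive terms of opposite
    signs, so that the sum telescopes. *)
Lemma is_derive_upper_gamma (m : nat) (x : R) :
  is_derive (upper_gamma m) x (- (x ^ m * exp (- x) / INR (fact m))).
Proof.
  induction m as [|m IH].
  - apply (is_derive_ext (fun x => exp (- x))).
    { intros y; unfold upper_gamma; simpl; field. }
    auto_derive; [exact I | simpl; field].
  - apply (is_derive_ext
             (fun x => upper_gamma m x
                       + x ^ S m * exp (- x) / INR (fact (S m)))).
    { intros y; unfold upper_gamma; simpl sum_f_R0; unfold Rdiv.
      rewrite Rmult_plus_distr_l; f_equal.
      rewrite <- Rmult_assoc; f_equal; apply Rmult_comm. }
    replace (- (x ^ S m * exp (- x) / INR (fact (S m))))
      with (- (x ^ m * exp (- x) / INR (fact m))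
            + (x ^ m * exp (- x) / INR (fact m)
               - x ^ S m * exp (- x) / INR (fact (S m)))) by ring.
    apply (is_derive_plus (upper_gamma m)
             (fun x => x ^ S m * exp (- x) / INR (fact (S m)))).
    + exact IH.
    + rewrite fact_simpl, mult_INR.
      set (c := INR (S m)).
      auto_derive; [exact I | ].
      change (match m with 0%nat => 1 | S _ => INR m + 1 end) with c.
      simpl; field; split; [apply INR_fact_neq_0 | now apply not_0_INR].
Qed.

Definition laplace_kernel (m : nat) (t s tau : R) : R :=
  (t - tau) ^ m * exp (- (t - tau) * s).

Lemma laplace_kernel_ge_0 (m : nat) (t s tau : R) :
  tau <= t -> 0 <= laplace_kernel m t s tau.
Proof.
  intros Htau; apply Rmult_le_pos; [apply pow_le; lra | left; apply exp_pos].
Qed.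

Lemma continuous_laplace_kernel (m : nat) (t s tau : R) :
  continuous (laplace_kernel m t s) tau.
Proof.
  apply (ex_derive_continuous (laplace_kernel m t s)).
  unfold laplace_kernel; auto_derive; exact I.
Qed.

Lemma is_RInt_laplace_kernel (m : nat) (a t s : R) :
  0 < s ->
  is_RInt (laplace_kernel m t s) a t
    (INR (fact m) / s ^ S m * (1 - upper_gamma m ((t - a) * s))).
Proof.
  intros Hs.
  pose (F := fun tau => INR (fact m) / s ^ S m * upper_gamma m ((t - tau) * s)).
  replace (INR (fact m) / s ^ S m * (1 - upper_gamma m ((t - a) * s)))
    with (minus (F t) (F a)).
  2: { unfold F, minus, plus, opp; simpl.
       rewrite Rminus_diag, Rmult_0_l, upper_gamma_0; ring. }
  apply (is_RInt_derive F).
  2: { intros tau _; apply continuous_laplace_kernel. }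
  intros tau _; unfold F, laplace_kernel.
  set (x := (t - tau) * s).
  replace ((t - tau) ^ m * exp (- (t - tau) * s))
    with (INR (fact m) / s ^ S m *
            (- s * - (x ^ m * exp (- x) / INR (fact m)))).
  2: { unfold x; rewrite Rpow_mult_distr, <- tech_pow_Rmult, Ropp_mult_distr_l.
       field; repeat split;
         [apply INR_fact_neq_0 | apply pow_nonzero | ]; lra. }
  apply (is_derive_scal (fun tau => upper_gamma m ((t - tau) * s))).
  apply (is_derive_comp (upper_gamma m) (fun tau => (t - tau) * s)).
  - apply is_derive_upper_gamma.
  - auto_derive; [exact I | ring].
Qed.

(** The kernel integrates to Gamma(m+1) / s^(m+1) over the half line below t,
    and [a, t] only misses a nonnegative tail. *)
Lemma laplace_RInt_le_Gamma (a b t s : R) (f : R -> R) (M : R) (m : nat) :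
  a <= t <= b ->
  continuous_on (fun x => a <= x <= b) f ->
  0 <= M -> (forall x, a <= x <= b -> Rabs (f x) <= M) ->
  0 < s ->
  Rabs (RInt (fun tau => laplace_kernel m t s tau * f tau) a t)
    <= M * INR (fact m) / s ^ S m.
Proof.
  intros Ht Hf HM0 HM Hs.
  eapply Rle_trans.
  - apply (Rabs_RInt_mult_le a b t f (laplace_kernel m t s)
             (laplace_kernel m t s) M
             (INR (fact m) / s ^ S m * (1 - upper_gamma m ((t - a) * s)))
             Ht Hf HM).
    + apply continuous_laplace_kernel.
    + intros x Hx; split; [now apply laplace_kernel_ge_0 | apply Rle_refl].
    + now apply is_RInt_laplace_kernel.
  - unfold Rdiv at 2; rewrite Rmult_assoc.
    apply Rmult_le_compat_l; [exact HM0 | ].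
    rewrite <- (Rmult_1_r (INR (fact m) * / s ^ S m)).
    apply Rmult_le_compat_l.
    + left; apply Rdiv_lt_0_compat; [apply INR_fact_lt_0 | now apply pow_lt].
    + assert (0 <= upper_gamma m ((t - a) * s)); [ | lra].
      apply upper_gamma_ge_0, Rmult_le_pos; lra.
Qed.

Lemma laplace_RInt_le_const (a b t s : R) (f : R -> R) (M : R) (m : nat) :
  a <= t <= b ->
  continuous_on (fun x => a <= x <= b) f ->
  (forall x, a <= x <= b -> Rabs (f x) <= M) ->
  0 < s ->
  Rabs (RInt (fun tau => laplace_kernel m t s tau * f tau) a t)
    <= M * ((t - a) * (t - a) ^ m).
Proof.
  intros Ht Hf HM Hs.
  apply (Rabs_RInt_mult_le a b t f (laplace_kernel m t s)
           (fun _ => (t - a) ^ m) M ((t - a) * (t - a) ^ m) Ht Hf HM).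
  - apply continuous_laplace_kernel.
  - intros x Hx; split; [now apply laplace_kernel_ge_0 | ].
    rewrite <- (Rmult_1_r ((t - a) ^ m)).
    apply Rmult_le_compat.
    + apply pow_le; lra.
    + left; apply exp_pos.
    + apply pow_incr; lra.
    + assert (Hy : 0 <= (t - x) * s) by (apply Rmult_le_pos; lra).
      rewrite <- exp_0, <- Ropp_mult_distr_l; destruct Hy as [Hy | <-].
      * left; apply exp_increasing; lra.
      * rewrite Ropp_0; apply Rle_refl.
  - exact (is_RInt_const a t ((t - a) ^ m)).
Qed.

(** * Increasing functions and powers *)

(** Monotonicity only on an open set is enough, because the sign of the
    derivative is read off from difference quotients with small increments. *)
Lemma Derive_ge_0_of_increasing_on (D : R -> Prop) (g : R -> R) (w : R) :
  open D -> (forall x y, D x -> D y -> x < y -> g x < g y) ->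
  D w -> ex_derive g w -> 0 <= Derive g w.
Proof.
  intros HD Hg Hw Hdg.
  apply Rnot_lt_le; intros Hneg.
  apply Derive_correct, is_derive_Reals in Hdg.
  destruct (Hdg (- Derive g w) ltac:(lra)) as [d1 Hd1].
  destruct (HD w Hw) as [d2 Hd2].
  pose (h := Rmin d1 d2 / 2).
  assert (Hmin : 0 < Rmin d1 d2) by (apply Rmin_pos; apply cond_pos).
  pose proof (Rmin_l d1 d2); pose proof (Rmin_r d1 d2).
  assert (Hh : 0 < h) by (unfold h; lra).
  assert (HDh : D (w + h)).
  { apply Hd2; change (Rabs (w + h - w) < d2).
    rewrite Rabs_pos_eq; unfold h in *; lra. }
  assert (Hq : 0 < (g (w + h) - g w) / h).
  { apply Rdiv_lt_0_compat; [ | exact Hh].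
    assert (g w < g (w + h)) by (apply Hg; auto; lra); lra. }
  specialize (Hd1 h ltac:(lra)).
  rewrite (Rabs_pos_eq h) in Hd1 by lra.
  specialize (Hd1 ltac:(unfold h in *; lra)).
  apply Rabs_def2 in Hd1; lra.
Qed.

Lemma nceil_pos (alpha : R) : 0 < alpha -> (1 <= nceil alpha)%nat.
Proof.
  intros Ha; unfold nceil.
  destruct (Zceil_bound alpha) as [_ H].
  assert (0 < Zceil alpha)%Z by (apply lt_IZR; lra); lia.
Qed.

Lemma Rpower_div_pow (s r : R) (n : nat) :
  0 < s -> Rpower s r / s ^ n = Rpower s (r - INR n).
Proof.
  intros Hs; unfold Rminus.
  now rewrite Rpower_plus, Rpower_Ropp, Rpower_pow.
Qed.

(** * The bounds for the transformed kernel *)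

Lemma Rabs_phi_le (Omega : R -> Prop) (psi : R -> R) (a t alpha w B : R)
    (f : R -> R) :
  admissible Omega psi -> Omega w ->
  Rabs (RInt (fun tau =>
          laplace_kernel (nceil alpha - 1) t (psi w) tau * f tau) a t) <= B ->
  Rabs (phi a f alpha psi t w)
    <= Rabs (c_coef alpha) * Derive psi w *
       Rpower (psi w) (INR (nceil alpha) - alpha - 1) * B.
Proof.
  intros Hadm Hw HB; unfold phi.
  assert (Hd : 0 <= Derive psi w).
  { apply (Derive_ge_0_of_increasing_on Omega); auto.
    - apply (oi_open _ (adm_dom _ _ Hadm)).
    - apply (adm_incr _ _ Hadm).
    - now apply (adm_derivable _ _ Hadm). }
  assert (Hp : 0 < Rpower (psi w) (INR (nceil alpha) - alpha - 1))
    by apply exp_pos.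
  rewrite !Rabs_mult, (Rabs_pos_eq (Derive psi w)) by exact Hd.
  rewrite (Rabs_pos_eq (Rpower _ _)) by lra.
  apply Rmult_le_compat_l; [ | exact HB].
  apply Rmult_le_pos; [ | lra].
  apply Rmult_le_pos; [apply Rabs_pos | exact Hd].
Qed.

Theorem theorem5 :
  forall (a b : R), a < b ->
  forall (f : R -> R), continuous_on (fun x => a <= x <= b) f ->
  forall (alpha : R), 0 < alpha ->
  (forall k : nat, (1 <= k)%nat -> alpha <> INR k) ->
  forall (Omega : R -> Prop) (psi : R -> R), admissible Omega psi ->
  forall (t : R), a <= t <= b ->
  (exists C : R,
     holds_to_sup Omega (fun w =>
       Rabs (phi a f alpha psi t w)
         <= C * Derive psi w * Rpower (psi w) (- alpha - 1)))
  /\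
  (exists C : R,
     holds_to_inf Omega (fun w =>
       Rabs (phi a f alpha psi t w)
         <= C * Derive psi w * Rpower (psi w) (INR (nceil alpha) - alpha - 1))).
Proof.
  intros a b Hab f Hf alpha Halpha _ Omega psi Hadm t Ht.
  destruct (oi_nonempty _ (adm_dom _ _ Hadm)) as [w0 Hw0].
  destruct (continuous_on_segment_extension a b f) as [g [Hg Hgf]];
    [lra | exact Hf | ].
  destruct (continuous_segment_bounded a b g) as [M [HM0 HMg]];
    [lra | exact Hg | ].
  assert (HM : forall x, a <= x <= b -> Rabs (f x) <= M).
  { intros x Hx; rewrite <- Hgf by exact Hx; now apply HMg. }
  pose proof (nceil_pos alpha Halpha) as Hn.
  set (m := (nceil alpha - 1)%nat).
  split.
  - exists (Rabs (c_coef alpha) * (M * INR (fact m))).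
    exists w0; split; [exact Hw0 | intros w Hw _].
    pose proof (adm_pos _ _ Hadm w Hw) as Hs.
    eapply Rle_trans.
    { apply (Rabs_phi_le Omega); [exact Hadm | exact Hw | ].
      now apply (laplace_RInt_le_Gamma a b t (psi w) f M). }
    fold m.
    right.
    replace (- alpha - 1) with (INR (nceil alpha) - alpha - 1 - INR (S m)).
    2: { replace (S m) with (nceil alpha) by (unfold m; lia); ring. }
    rewrite <- Rpower_div_pow by exact Hs.
    unfold Rdiv; ring.
  - exists (Rabs (c_coef alpha) * (M * ((t - a) * (t - a) ^ m))).
    exists w0; split; [exact Hw0 | intros w Hw _].
    pose proof (adm_pos _ _ Hadm w Hw) as Hs.
    eapply Rle_trans.
    { apply (Rabs_phi_le Omega); [exact Hadm | exact Hw | ].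
      now apply (laplace_RInt_le_const a b t (psi w) f M). }
    fold m; right; ring.
Qed.
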